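(* Let $\psi(z)=1+\sum_{k\ge 1}\psi_k z^k$ be a formal power series with real coefficients. Let $L(z)=\sum_{m\ge 0}L_m z^m$ be a power series with real coefficients (whose values $L(k)$, $k\ge 1$ an integer, make sense), and let $B:\mathcal{R}\to\mathbb{R}$ be the bare Green function associated with a sequence $(B_k)_{k\ge 1}$ satisfying $B_k=L(k)/k$ for all integers $k\ge 1$. Then the formal power series $$Y(z)=\sum_{t\in\mathcal{R}}\frac{z^{|t|}}{|t|!}\,\alpha(t)\,t!\,B(t)\,\delta_t$$ solves $$Y'=L(1+\theta)\,\psi(Y),$$ as an identity of formal power series in $z$.
   Context: $\mathcal{R}$ is the set of (isomorphism classes of) finite non-empty rooted trees, non-planar and unlabelled; $|t|$ is the number of nodes of $t$. $B_+(t_1,\dots,t_k)$ denotes the rooted tree obtained by creating a new root and joining it to the roots of $t_1,\dots,t_k$; every $t\in\mathcal{R}$ is of this form, with $k$ the number of children of the root ($k=0$ for the one-node tree). Bare Green function: given a real sequence $(B_k)_{k\ge1}$, $B$ is defined recursively by $B(t)=B_{|t|}\prod_{i=1}^k B(t_i)$ for $t=B_+(t_1,\dots,t_k)$. Tree factorial: $t!=|t|\prod_{i=1}^k t_i!$ for $t=B_+(t_1,\dots,t_k)$. $\alpha(t)$: the number of rooted labelled trees of shape $t$, i.e. the number, up to isomorphism of labelled rooted trees, of bijective labellings $l:V\to\{1,\dots,|t|\}$ of the nodes of $t$ with $l(u)<l(v)$ whenever $u\neq v$ and $u$ lies on the path from the root to $v$. Elementary differentials: $\delta_{t}=1$ for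 the one-node tree and $\delta_t=\psi^{(k)}(0)\prod_{i=1}^k\delta_{t_i}$ for $t=B_+(t_1,\dots,t_k)$, where $\psi^{(k)}(0)=k!\,\psi_k$. $\theta=z\,\frac{d}{dz}$ is Euler's operator, and $L(1+\theta)=L(\theta+1)$ is the formal operator acting on power series by $L(\theta+1)\big(\sum_{m\ge0}a_mz^m\big)=\sum_{m\ge 0}a_m L(m+1)z^m$. Convergence questions are ignored; everything is at the level of formal power series. *)

(* Defs.v *)
From HB Require Import structures.
From mathcomp Require Import all_boot all_order all_algebra.
From mathcomp Require Import generic_quotient finmap.
From mathcomp Require Import boolp classical_sets functions cardinality fsbigop.
From mathcomp Require Import reals topology normedtype sequences exp.

Set Implicit Arguments.
Unset Strict Implicit.
Unset Printing Implicit Defensive.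

Import Order.TTheory GRing.Theory Num.Theory.
Import numFieldNormedType.Exports.

Local Open Scope classical_set_scope.
Local Open Scope quotient_scope.
Local Open Scope ring_scope.

(* Plane rooted trees with a decoration in [L] at every node. Rooted trees are
   the quotient [rtree] below, with [L := unit]; labelled rooted trees are the
   quotient [lrtree], with [L := nat]. *)
Inductive tree (L : Type) : Type := Node of L & seq (tree L).

Section PlaneTrees.
Variable L : Type.
Implicit Types t : tree L.

Definition tree_nested_ind (P : tree L -> Prop)
    (H : forall x ts, foldr (fun t => and (P t)) True ts -> P (Node x ts)) :
    forall t, P t :=
  fix ind t := let: Node x ts := t in
    H x ts ((fix inds s : foldr (fun t => and (P t)) True s :=
      if s is u :: s' then conj (ind u) (inds s') else I) ts).

Fixpoint tsize t : nat := let: Node _ ts := t in (sumn (map tsize ts)).+1.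

Fixpoint labels t : seq L :=
  let: Node x ts := t in x :: flatten (map labels ts).

Fixpoint tmap (M : Type) (f : L -> M) t : tree M :=
  let: Node x ts := t in Node (f x) (map (tmap f) ts).

(* The recursion scheme f(B_+(t_1,...,t_k)) = F |t| [f(t_1),...,f(t_k)]. *)
Fixpoint tfold (A : Type) (F : nat -> seq A -> A) t : A :=
  let: Node _ ts := t in F (tsize t) (map (tfold F) ts).

Fixpoint tree_encode t : GenTree.tree L :=
  let: Node x ts := t in
  GenTree.Node 0 (GenTree.Leaf x :: map tree_encode ts).

Fixpoint tree_decode (u : GenTree.tree L) : option (tree L) :=
  if u is GenTree.Node _ (GenTree.Leaf x :: us)
  then Some (Node x (pmap tree_decode us)) else None.

Lemma tree_encodeK : pcancel tree_encode tree_decode.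
Proof.
elim/tree_nested_ind => x ts IH /=; congr (Some (Node _ _)).
by elim: ts IH => //= t ts IHts [-> /IHts /= ->].
Qed.

End PlaneTrees.

HB.instance Definition _ (L : eqType) :=
  Equality.copy (tree L) (pcan_type (@tree_encodeK L)).
HB.instance Definition _ (L : choiceType) :=
  Choice.copy (tree L) (pcan_type (@tree_encodeK L)).

(* Labels strictly increase along every path going away from the root. *)
Fixpoint increasing (t : tree nat) : bool :=
  let: Node x ts := t in
  all (fun y => x < y)%N (flatten (map (@labels nat) ts)) && all increasing ts.

(* Isomorphism of decorated rooted trees: same decoration at the root, and the
   subtrees at the root match up to reordering and isomorphism. *)
Fixpoint tree_iso (L : eqType) (t u : tree L) : bool :=
  let: Node x ts := t in let: Node y us := u in
  (x == y) && has (all2 (@tree_iso L) ts) (permutations us).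

Section Isomorphism.
Variable L : eqType.
Implicit Types t u v : tree L.

Lemma tree_seq_ind (P : tree L -> Prop) :
  (forall x ts, {in ts, forall t, P t} -> P (Node x ts)) -> forall t, P t.
Proof.
move=> H; elim/tree_nested_ind => x ts IH; apply: H.
elim: ts IH => //= u ts IHts [Pu /IHts Pts] t.
by rewrite inE => /predU1P[->|/Pts].
Qed.

Lemma tree_isoP x y (ts us : seq (tree L)) :
  reflect (x = y /\ exists2 us', perm_eq us' us & all2 (@tree_iso L) ts us')
          (tree_iso (Node x ts) (Node y us)).
Proof.
apply: (iffP andP) => [[/eqP -> /hasP[us']]|[-> [us' pus tu]]].
  by rewrite mem_permutations => pus tu; split=> //; exists us'.
by split=> //; apply/hasP; exists us'; rewrite // mem_permutations.
Qed.

Lemma perm_all2 (A B : eqType) (r : A -> B -> bool)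
    (s s' : seq A) (u : seq B) :
  perm_eq s s' -> all2 r s u -> exists2 u', perm_eq u' u & all2 r s' u'.
Proof.
move=> ss'; rewrite all2E => /andP[/eqP su rsu].
case: s => [|x0 s] in ss' su rsu *.
  move: ss'; rewrite perm_sym => /perm_nilP ->.
  by exists u => //; rewrite all2E -su eqxx.
case: u => // y0 u in su rsu *.
set s1 := x0 :: s in ss' su rsu *; set u1 := y0 :: u in su rsu *.
clearbody s1 u1.
move: ss'; rewrite perm_sym => /(perm_iotaP x0)[Is pIs ->].
have pu : perm_eq [seq nth y0 u1 i | i <- Is] u1.
  rewrite -[X in perm_eq _ X](mkseq_nth y0) perm_map//.
  by rewrite -su; apply: perm_trans pIs _.
exists [seq nth y0 u1 i | i <- Is] => //.
rewrite all2E !size_map eqxx /=.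
have -> : zip [seq nth x0 s1 i | i <- Is] [seq nth y0 u1 i | i <- Is] =
          [seq nth (x0, y0) (zip s1 u1) i | i <- Is].
  elim: (Is) => //= i I ->; congr (_ :: _).
  by rewrite nth_zip.
rewrite all_map; apply/allP => i.
rewrite (perm_mem pIs) mem_iota /= => ilt.
apply: (allP rsu); apply: mem_nth.
by rewrite size_zip -su minnn.
Qed.

Lemma tree_iso_refl : reflexive (@tree_iso L).
Proof.
elim/tree_seq_ind => x ts IH; apply/tree_isoP; split=> //; exists ts => //.
elim: ts IH => //= t ts IHts IH; rewrite IH ?mem_head//=.
by apply: IHts => u uts; apply: IH; rewrite inE uts orbT.
Qed.

Lemma tree_iso_sym : symmetric (@tree_iso L).
Proof.
suff H t u : tree_iso t u -> tree_iso u t by move=> t u; apply/idP/idP; exact: H.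
elim/tree_seq_ind: t u => x ts IH [y us] /tree_isoP[-> [us' pus tu]].
have {tu} : all2 (@tree_iso L) us' ts.
  elim: ts IH us' {pus} tu => [|t ts IHts] IH [|u us'] //= /andP[tu tus].
  rewrite IH ?mem_head//=; apply: IHts => // v vts.
  by apply: IH; rewrite inE vts orbT.
by move=> /(perm_all2 pus)[ts' pts ut]; apply/tree_isoP; split=> //; exists ts'.
Qed.

Lemma tree_iso_trans : transitive (@tree_iso L).
Proof.
move=> u t v; elim/tree_seq_ind: t u v => x ts IH [y us] [z vs].
move=> /tree_isoP[-> [us' pus tu]] /tree_isoP[-> [vs' pvs uv]].
move: (pus); rewrite perm_sym => /perm_all2 /(_ uv)[vs'' pvs'' u'v]; apply/tree_isoP; split=> //.
exists vs''; first exact: perm_trans pvs'' pvs.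
elim: ts IH us' vs'' tu u'v {pus pvs''} => [|t ts IHts] IH [|u us'] [|v vs''] //=.
move=> /andP[tu tus] /andP[uv' uvs].
rewrite (IH _ _ u)//= ?mem_head//; apply: (IHts _ us') => // w wts.
by apply: IH; rewrite inE wts orbT.
Qed.

Lemma tsize_iso t u : tree_iso t u -> tsize t = tsize u.
Proof.
elim/tree_seq_ind: t u => x ts IH [y us] /tree_isoP[_ [us' pus tu]] /=.
congr _.+1; rewrite -(perm_sumn (perm_map _ pus)).
elim: ts IH us' {pus} tu => [|t ts IHts] IH [|u us'] //= /andP[tu tus].
rewrite (IH _ _ u) ?mem_head// (IHts _ us')// => v vts.
by apply: IH; rewrite inE vts orbT.
Qed.

Lemma tfold_iso (A : eqType) (F : nat -> seq A -> A) t u :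
    (forall n s s', perm_eq s s' -> F n s = F n s') ->
  tree_iso t u -> tfold F t = tfold F u.
Proof.
move=> FP; elim/tree_seq_ind: t u => x ts IH [y us] tu.
change (F (tsize (Node x ts)) (map (tfold F) ts) =
        F (tsize (Node y us)) (map (tfold F) us)); rewrite (tsize_iso tu).
move: tu => /tree_isoP[_ [us' pus tu]].
rewrite -(FP _ _ _ (perm_map (tfold F) pus)); congr (F _ _).
elim: ts IH us' {pus} tu => [|t ts IHts] IH [|u us'] //= /andP[tu tus].
rewrite (IH _ _ u) ?mem_head// (IHts _ us')// => v vts.
by apply: IH; rewrite inE vts orbT.
Qed.

End Isomorphism.

Canonical tree_iso_equiv (L : eqType) :=
  EquivRel (@tree_iso L) (@tree_iso_refl L) (@tree_iso_sym L) (@tree_iso_trans L).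

Definition rtree := {eq_quot (tree_iso_equiv unit)}.
HB.instance Definition _ : EqQuotient _ (tree_iso_equiv unit) rtree :=
  EqQuotient.on rtree.
HB.instance Definition _ := Choice.on rtree.

Definition lrtree := {eq_quot (tree_iso_equiv nat)}.
HB.instance Definition _ : EqQuotient _ (tree_iso_equiv nat) lrtree :=
  EqQuotient.on lrtree.
HB.instance Definition _ := Choice.on lrtree.

Definition Bplus (ts : seq rtree) : rtree := \pi_rtree (Node tt (map repr ts)).

Definition rsize (t : rtree) : nat := tsize (repr t).

Definition rfold (A : Type) (F : nat -> seq A -> A) (t : rtree) : A :=
  tfold F (repr t).

Lemma repr_iso (u : tree unit) : tree_iso (repr (\pi_rtree u)) u.
Proof. by apply/(@eqquotP _ (tree_iso_equiv unit) rtree); rewrite reprK. Qed.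

Lemma rsizeE (u : tree unit) : rsize (\pi_rtree u) = tsize u.
Proof. exact/tsize_iso/repr_iso. Qed.

Lemma rsize_Bplus ts : rsize (Bplus ts) = (\sum_(t <- ts) rsize t).+1.
Proof. by rewrite rsizeE /= sumnE !big_map. Qed.

(* [rfold] does not depend on the choice of representatives. *)
Lemma rfold_Bplus (A : eqType) (F : nat -> seq A -> A) ts :
    (forall n s s', perm_eq s s' -> F n s = F n s') ->
  rfold F (Bplus ts) = F (rsize (Bplus ts)) (map (rfold F) ts).
Proof.
move=> FP; rewrite /rfold (tfold_iso FP (repr_iso _)) rsizeE /=.
by congr (F _ _); rewrite -map_comp.
Qed.

Lemma Bplus_surj (t : rtree) : exists ts, t = Bplus ts.
Proof.
elim/quotW: t => -[[] ts]; exists (map \pi_rtree ts).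
apply/(@eqquotP _ (tree_iso_equiv unit) rtree).
apply/tree_isoP; split=> //; exists (map repr (map \pi_rtree ts)) => //.
elim: ts => //= t ts ->; rewrite andbT tree_iso_sym; exact: repr_iso.
Qed.

Definition tree_factorial : rtree -> nat :=
  rfold (fun n vs => n * \prod_(v <- vs) v)%N.

Lemma tree_factorial_Bplus ts :
  tree_factorial (Bplus ts) =
  (rsize (Bplus ts) * \prod_(t <- ts) tree_factorial t)%N.
Proof.
by rewrite /tree_factorial rfold_Bplus /= ?big_map// => n s s' p; rewrite (perm_big _ p).
Qed.

Definition bare_green (R : realType) (b : nat -> R) : rtree -> R :=
  rfold (fun n vs => b n * \prod_(v <- vs) v).

Lemma bare_green_Bplus (R : realType) (b : nat -> R) ts :
  bare_green b (Bplus ts) =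
  b (rsize (Bplus ts)) * \prod_(t <- ts) bare_green b t.
Proof.
by rewrite /bare_green rfold_Bplus /= ?big_map// => n s s' p; rewrite (perm_big _ p).
Qed.

(* [psi] is the sequence of coefficients, so that the k-th derivative of the
   series at 0 is k! psi_k. *)
Definition elem_diff (R : realType) (psi : nat -> R) : rtree -> R :=
  rfold (fun _ vs => if vs is [::] then 1
    else ((size vs)`!)%:R * psi (size vs) * \prod_(v <- vs) v).

Lemma elem_diff_Bplus (R : realType) (psi : nat -> R) ts :
  elem_diff psi (Bplus ts) =
  if ts is [::] then 1
  else ((size ts)`!)%:R * psi (size ts) * \prod_(t <- ts) elem_diff psi t.
Proof.
rewrite /elem_diff rfold_Bplus; last first.
  move=> _ [|a s] [|a' s'] p //; try by have := perm_size p.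
  by rewrite (perm_big _ p) (perm_size p).
by case: ts => // t ts; rewrite -(big_map (elem_diff psi) xpredT id) /= size_map.
Qed.

Lemma finite_tree (L : eqType) (a : seq L) n :
  finite_set [set t : tree L | (tsize t <= n)%N /\ {subset labels t <= a}].
Proof.
suff [s sP] : exists s : seq (tree L), forall t,
    (tsize t <= n)%N -> {subset labels t <= a} -> t \in s.
  by apply: sub_finite_set (finite_seq s) => t [tn ta]; apply: sP.
elim: n => [|n [s sP]]; first by exists [::] => -[].
have [fs fsP] : exists fs : seq (seq (tree L)), forall ts,
    (sumn (map (@tsize L) ts) <= n)%N ->
    {subset flatten (map (@labels L) ts) <= a} -> ts \in fs.
  suff [fs fsP] : exists fs : seq (seq (tree L)), forall ts, (size ts <= n)%N ->
      {subset ts <= s} -> ts \in fs.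
    exists fs => ts tsn tsa; apply: fsP.
      apply: leq_trans tsn; elim: ts {tsa} => //= -[x us] ts IH.
      by rewrite addSn ltnS (leq_trans IH)// leq_addl.
    move=> t tts; apply: sP.
      apply: leq_trans tsn; elim: ts tts {tsa} => //= u ts IH.
      rewrite inE => /predU1P[->|/IH]; first exact: leq_addr.
      by move/leq_trans; apply; exact: leq_addl.
    move=> x xt; apply: tsa; apply/flattenP; exists (labels t) => //.
    exact: map_f.
  elim: n {sP} => [|m [fs fsP]].
    by exists [:: [::]] => -[|//].
  exists ([::] :: [seq t :: ts | t <- s, ts <- fs]) => -[//|t ts] /= tsm tss.
  rewrite inE /=; apply/allpairsP; exists (t, ts) => /=; split=> //.
    by apply: tss; rewrite mem_head.
  by apply: fsP => // u uts; apply: tss; rewrite inE uts orbT.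
exists [seq Node x ts | x <- a, ts <- fs] => -[x ts] /=; rewrite ltnS => tn ta.
apply/allpairsP; exists (x, ts) => /=; split=> //.
  by apply: ta; rewrite mem_head.
by apply: fsP => // y yts; apply: ta; rewrite inE yts orbT.
Qed.

Definition rtrees n : set rtree := [set t | rsize t = n].

Lemma finite_rtrees n : finite_set (rtrees n).
Proof.
apply: sub_finite_set (finite_image \pi_rtree (finite_tree [:: tt] n)) => t.
move=> /= tn; exists (repr t); last by rewrite reprK.
by split; [rewrite -tn | move=> []].
Qed.

(* The labelled rooted trees of shape [t], as isomorphism classes: nodes are
   labelled bijectively by 1, ..., |t|, increasingly from the root. *)
Definition labellings (t : rtree) : set lrtree :=
  [set \pi_lrtree T | T in [set T : tree nat |
    [/\ \pi_rtree (tmap (fun=> tt) T) = t,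
        perm_eq (labels T) (iota 1 (rsize t)) & increasing T]]].

Lemma tsize_map (L M : Type) (f : L -> M) t : tsize (tmap f t) = tsize t.
Proof.
elim/tree_nested_ind: t => x ts IH /=; congr _.+1.
by elim: ts IH => //= t ts IHts [-> /IHts ->].
Qed.

Lemma finite_labellings t : finite_set (labellings t).
Proof.
apply: finite_image.
apply: sub_finite_set (finite_tree (iota 1 (rsize t)) (rsize t)) => T.
move=> /= [Tt lT _]; split; first by rewrite -Tt rsizeE tsize_map.
by move=> x; rewrite (perm_mem lT).
Qed.

Definition alpha (t : rtree) : nat := #|` fset_set (labellings t)|.

(* A formal power series is identified with its sequence of coefficients; its
   formal derivative is [pseries_diffs]. *)
Definition fps_mul (R : realType) (f g : nat -> R) : nat -> R :=
  fun m => \sum_(i < m.+1) f i * g (m - i)%N.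

Definition fps_one (R : realType) : nat -> R := fun m => (m == 0%N)%:R.

Definition fps_exp (R : realType) (f : nat -> R) (k : nat) : nat -> R :=
  iter k (fps_mul f) (fps_one R).

(* Composition f(g) of formal power series, meaningful when g_0 = 0; then the
   coefficient of z^m in g^k vanishes for k > m ([fps_exp_small]), whence the
   truncation. *)
Definition fps_comp (R : realType) (f g : nat -> R) : nat -> R :=
  fun m => \sum_(k < m.+1) f k * fps_exp g k m.

Lemma fps_exp_small (R : realType) (g : nat -> R) k m :
  g 0%N = 0 -> (m < k)%N -> fps_exp g k m = 0.
Proof.
move=> g0; elim: k m => // k IH m mk; rewrite /fps_exp iterS.
apply: big1 => -[[|i] /= ilt] _; first by rewrite g0 mul0r.
rewrite [iter _ _ _ _](IH (m - i.+1)%N) ?mulr0//.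
case: m mk ilt => // m; rewrite !ltnS subSS => mk _.
by apply: leq_ltn_trans mk; exact: leq_subr.
Qed.

Definition series_value (R : realType) (L : nat -> R) (x : R) : R :=
  limn (pseries L x).

(* L(1 + theta), with theta = z d/dz. *)
Definition op_1theta (R : realType) (L : nat -> R) (a : nat -> R) : nat -> R :=
  fun m => a m * series_value L m.+1%:R.

(* The coefficient of z^n is the sum over the (finitely many) trees with n
   nodes. *)
Definition tree_series (R : realType) (b psi : nat -> R) : nat -> R :=
  fun n => \sum_(t \in rtrees n)
    (((rsize t)`!)%:R)^-1 * (alpha t)%:R * (tree_factorial t)%:R *
    bare_green b t * elem_diff psi t.

Lemma tree_series0 (R : realType) (b psi : nat -> R) : tree_series b psi 0 = 0.
Proof.
rewrite /tree_series (_ : rtrees 0 = set0) ?fsbig_set0//.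
by rewrite -subset0 => t; rewrite /rtrees /= /rsize; case: (repr t).
Qed.

(* Main.v *)
(* The number [alpha t] counts increasing labelled trees of shape [t], so [Y] is
   the exponential generating function of increasing labelled trees weighted by
   [t! B(t) delta_t], a weight that is multiplicative over the subtrees of the
   root. In a forest on a label set with minimum [x], the node [x] is the root of
   one tree: removing it leaves two forests on complementary label sets, the
   children of [x] and the remaining trees. Hence the generating function [F_k] of
   forests with [k] trees satisfies [F_(k+1)' = Y' F_k], so [F_k = Y^k / k!], and
   summing over the degree [k] of the root of a tree gives the equation. *)
Require Import Defs.
From mathcomp Require Import all_boot all_order all_algebra.
From mathcomp Require Import generic_quotient finmap.
From mathcomp Require Import boolp classical_sets cardinality fsbigop.
From mathcomp Require Import reals topology normedtype sequences exp.
From mathcomp Require Import ring.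
Set Implicit Arguments.
Unset Strict Implicit.
Unset Printing Implicit Defensive.

Import GRing.Theory Num.Theory numFieldNormedType.Exports.
Local Open Scope classical_set_scope.
Local Open Scope quotient_scope.
Local Open Scope ring_scope.

(** * Splittings of a label list and the forests built from them *)

Fixpoint splits (s : seq nat) : seq (seq nat * seq nat) :=
  if s is x :: s' then
    [seq (x :: p.1, p.2) | p <- splits s'] ++
    [seq (p.1, x :: p.2) | p <- splits s']
  else [:: ([::], [::])].

Definition flabels (ts : seq (tree nat)) : seq nat :=
  flatten (map (@labels nat) ts).

(* The labelled forests with label set [s], one plane representative for each;
   [n] is recursion fuel, and [size s <= n] is enough. *)
Fixpoint forests (n : nat) (s : seq nat) : seq (seq (tree nat)) :=
  match s, n with
  | [::], _ => [:: [::]]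
  | x :: s', n'.+1 =>
      [seq Node x q.1 :: q.2 | p <- splits s',
         q <- [seq (f, g) | f <- forests n' p.1, g <- forests n' p.2]]
  | _, _ => [::]
  end.

Definition root_lt : rel (tree nat) :=
  fun t u => let: Node x _ := t in let: Node y _ := u in (x < y)%N.

(* Sorting siblings by root label selects one plane representative in every
   isomorphism class of increasing trees with distinct labels. *)
Fixpoint canonical (t : tree nat) : bool :=
  let: Node _ ts := t in sorted root_lt ts && all canonical ts.

Lemma mem_splits s p : p \in splits s ->
  [/\ subseq p.1 s, subseq p.2 s & perm_eq (p.1 ++ p.2) s].
Proof.
elim: s p => [|x s IH] p /=; first by rewrite inE => /eqP ->.
rewrite mem_cat => /orP[] /mapP[q /IH [s1 s2 ps] ->] /=.
- split; [by rewrite eqxx| by apply: subseq_trans s2 (subseq_cons _ _)|].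
  by rewrite perm_cons.
- split; [by apply: subseq_trans s1 (subseq_cons _ _)|by rewrite eqxx|].
  rewrite -cat1s perm_catCA /= perm_cons; exact: ps.
Qed.

Lemma splits_perm s a b : perm_eq (a ++ b) s ->
  exists2 p, p \in splits s & perm_eq a p.1 /\ perm_eq b p.2.
Proof.
elim: s a b => [|x s IH] a b /=.
  by case: a b => [|? ?] [|? ?] /perm_size //= _; exists ([::], [::]); rewrite ?inE.
move=> pab; have : x \in a ++ b by rewrite (perm_mem pab) mem_head.
rewrite mem_cat => /orP[xa|xb].
- have pa := perm_to_rem xa.
  have /IH[p ps [p1 p2]] : perm_eq (rem x a ++ b) s.
    by rewrite -(perm_cons x) -cat_cons -(permPr pab) perm_cat2r perm_sym.
  exists (x :: p.1, p.2); first by rewrite mem_cat map_f.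
  by split=> //=; rewrite (permPl pa) perm_cons.
- have pb := perm_to_rem xb.
  have /IH[p ps [p1 p2]] : perm_eq (a ++ rem x b) s.
    rewrite -(perm_cons x) -(permPr pab) -cat1s perm_catCA /=.
    by rewrite perm_cat2l perm_sym.
  exists (p.1, x :: p.2).
    by rewrite mem_cat [X in _ || X]map_f ?orbT // => ?.
  by split=> //=; rewrite (permPl pb) perm_cons.
Qed.

Lemma splits_uniq s : uniq s -> uniq (splits s).
Proof.
elim: s => //= x s IH /andP[xs us]; rewrite cat_uniq !map_inj_uniq ?IH //=.
- rewrite andbT; apply/hasPn => _ /mapP[p ps ->].
  apply/mapP => -[q qs [p1 _]].
  have [/mem_subseq sp _ _] := mem_splits ps.
  by move/negP: xs; apply; apply: sp; rewrite p1 mem_head.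
- by move=> [? ?] [? ?] /= [-> ->].
- by move=> [? ?] [? ?] /= [-> ->].
Qed.

(** Each half keeps the order of [s], and a strictly increasing list is determined by its set of
    entries. *)
Lemma splits_inj s p q : sorted ltn s -> p \in splits s -> q \in splits s ->
  perm_eq p.1 q.1 -> perm_eq p.2 q.2 -> p = q.
Proof.
move=> ss /mem_splits[p1 p2 _] /mem_splits[q1 q2 _] /perm_mem e1 /perm_mem e2.
have srt r : subseq r s -> sorted ltn r.
  by move/subseq_sorted; apply=> //; exact: ltn_trans.
have ltn_eq := irr_sorted_eq ltn_trans ltnn.
by case: p q => [? ?] [? ?] /= in p1 p2 q1 q2 e1 e2 *; congr (_, _);
  apply: ltn_eq => //; apply: srt.
Qed.

Lemma forests_consP n x s f :
  reflect (exists p g h, [/\ p \in splits s, g \in forests n p.1,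
             h \in forests n p.2 & f = Node x g :: h])
          (f \in forests n.+1 (x :: s)).
Proof.
apply: (iffP allpairsPdep) => /=.
  move=> [p [_ [ps /allpairsP[q [q1 q2 ->]] ->]]].
  by exists p, q.1, q.2.
move=> [p [g [h [ps gs hs ->]]]]; exists p, (g, h); split=> //.
by apply/allpairsP; exists (g, h).
Qed.

Lemma forests_labels n s f : f \in forests n s -> perm_eq (flabels f) s.
Proof.
elim: n s f => [|n IH] [|x s] f; rewrite ?inE //; try by move=> /eqP ->.
move=> /forests_consP[p [g [h [/mem_splits[_ _ ps] /IH gp /IH hp ->]]]].
rewrite /flabels /= perm_cons -(permPr ps); exact: perm_cat.
Qed.

Lemma forests_size n s f : f \in forests n s -> (size f <= size s)%N.
Proof.
move/forests_labels/perm_size <-; elim: f => //= -[x ts] f IH.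
by rewrite /flabels /= ltnS size_cat; apply: leq_trans IH (leq_addl _ _).
Qed.

Lemma forests_increasing n s f : sorted ltn s -> f \in forests n s ->
  all increasing f.
Proof.
elim: n s f => [|n IH] [|x s] f ss; rewrite ?inE //; try by move=> /eqP ->.
move=> /forests_consP[p [g [h [/mem_splits[s1 s2 _] gp hp ->]]]] /=.
have srt r : subseq r s -> sorted ltn r.
  by move/subseq_sorted; apply; [exact: ltn_trans|exact: path_sorted ss].
rewrite (IH _ _ (srt _ s1) gp) (IH _ _ (srt _ s2) hp) !andbT.
apply/allP => y; rewrite (perm_mem (forests_labels gp)) => /(mem_subseq s1).
by move: ss; rewrite /= (path_sortedE ltn_trans) => /andP[/allP xs _] /xs.
Qed.

Lemma root_lt_trans : transitive root_lt.
Proof. by move=> [y ?] [x ?] [z ?]; exact: ltn_trans. Qed.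

(** The head of the increasing list [s] is its minimum and becomes the root of the first tree, so
    this root precedes all the others. *)
Lemma forests_canonical n s f : sorted ltn s -> f \in forests n s ->
  sorted root_lt f && all canonical f.
Proof.
elim: n s f => [|n IH] [|x s] f ss; rewrite ?inE //; try by move=> /eqP ->.
move=> /forests_consP[p [g [h [/mem_splits[s1 s2 _] gp hp ->]]]].
have srt r : subseq r s -> sorted ltn r.
  by move/subseq_sorted; apply; [exact: ltn_trans|exact: path_sorted ss].
have /andP[sg cg] := IH _ _ (srt _ s1) gp.
have /andP[sh ch] := IH _ _ (srt _ s2) hp.
rewrite /= (path_sortedE root_lt_trans) sh sg cg ch !andbT.
apply/allP => -[y us] uh /=.
have ys : y \in s.
  apply: (mem_subseq s2); rewrite -(perm_mem (forests_labels hp)).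
  by apply/flattenP; exists (labels (Node y us)); rewrite ?map_f //= mem_head.
by move: ss => /=; rewrite (path_sortedE ltn_trans) => /andP[/allP/(_ y ys)].
Qed.

(** The labels below the first root and those of the other trees recover the split by [splits_inj],
    so different splits never build the same forest. *)
Lemma forests_uniq n s : sorted ltn s -> uniq (forests n s).
Proof.
elim: n s => [|n IH] [|x s] // ss.
have {}ss : sorted ltn s by exact: path_sorted ss.
have us : uniq s by apply: sorted_uniq ss; [exact: ltn_trans|exact: ltnn].
have srt r : subseq r s -> sorted ltn r.
  by move/subseq_sorted; apply=> //; exact: ltn_trans.
apply: allpairs_uniq_dep; first exact: splits_uniq.
- move=> p /mem_splits[s1 s2 _]; apply: allpairs_uniq; rewrite ?IH ?srt //.
  by move=> [? ?] [? ?].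
- move=> u v /allpairsPdep[p [q [ps /allpairsP[[g h] [/= gp hp ->]] ->]]].
  move=> /allpairsPdep[p' [q' [ps' /allpairsP[[g' h'] [/= gp' hp' ->]] ->]]].
  move=> /= [eg eh]; rewrite {}eg {}eh in gp hp *.
  suff -> : p = p' by [].
  apply: splits_inj ps ps' _ _ => //.
  - by rewrite -(permPl (forests_labels gp)) (forests_labels gp').
  - by rewrite -(permPl (forests_labels hp)) (forests_labels hp').
Qed.

(* Forests are compared through [tree_iso] by hanging them below a common root. *)
Lemma forests_surj n s ts : (size s <= n)%N -> sorted ltn s ->
    all increasing ts -> perm_eq (flabels ts) s ->
  exists2 f, f \in forests n s & forall x, tree_iso (Node x ts) (Node x f).
Proof.
elim: n s ts => [|n IH] [|x s] ts //; [move=> _ _ _|move=> _ _ _|].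
- case: ts => [|[y us] ts /perm_size] // _.
  by exists [::] => [|x]; [rewrite inE|move: (@tree_iso_refl nat (Node x nil)); exact].
- case: ts => [|[y us] ts /perm_size] // _.
  by exists [::] => [|x]; [rewrite inE|exact: tree_iso_refl].
move=> sn ss its pts; have {}sn : (size s <= n)%N by [].
have : x \in flabels ts by rewrite (perm_mem pts) mem_head.
move=> /flattenP[_ /mapP[[y us] tts ->] xt].
have /andP[xs {}ss] : all (ltn x) s && sorted ltn s.
  by move: ss; rewrite /= (path_sortedE ltn_trans).
have ptr := perm_to_rem tts; set ts' := rem _ ts in ptr.
have pl : perm_eq (flabels ts) (y :: flabels us ++ flabels ts').
  by rewrite (permPl (perm_flatten (perm_map _ ptr))).
have /= /andP[/allP yus ius] := allP its _ tts.
(* The tree containing the minimum [x] has it at its root: below the root [y] it would satisfy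
   [y < x]. *)
have xy : x = y.
  have : y \in x :: s.
    by rewrite -(perm_mem pts) (perm_mem pl) mem_head.
  rewrite inE => /predU1P[->|/(allP xs) /= lxy] //.
  move: xt; rewrite inE => /predU1P[//|/yus].
  by rewrite ltnNge ltnW.
subst y.
have /splits_perm[p ps [p1 p2]] : perm_eq (flabels us ++ flabels ts') s.
  by rewrite -(perm_cons x) -(permPl pl).
have [s1 s2 _] := mem_splits ps.
have srt r : subseq r s -> sorted ltn r.
  by move/subseq_sorted; apply=> //; exact: ltn_trans.
have its' : all increasing ts'.
  by apply/allP => t /mem_rem /(allP its).
have [g gp gi] := IH _ _ (leq_trans (size_subseq s1) sn) (srt _ s1) ius p1.
have [h hp hi] := IH _ _ (leq_trans (size_subseq s2) sn) (srt _ s2) its' p2.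
exists (Node x g :: h); first by apply/forests_consP; exists p, g, h.
move=> z; have /tree_isoP[_ [h' ph th]] := hi z.
(* The intermediate forest is [ts] with the tree containing [x] moved to the front; its tail is
   matched with [h'], a reordering of [h]. *)
apply: (@tree_iso_trans _ (Node z (Node x us :: ts')) (Node z ts)
  (Node z (Node x g :: h))).
  rewrite tree_iso_sym; apply/tree_isoP; split=> //.
  exists (Node x us :: ts'); first by rewrite perm_sym.
  by elim: (_ :: _) => //= u us' ->; rewrite tree_iso_refl.
apply/tree_isoP; split=> //; exists (Node x g :: h'); first by rewrite perm_cons.
exact/andP.
Qed.

(** * Counting the labellings of a rooted tree *)

Lemma canonical_iso_eq t u : canonical t -> canonical u -> tree_iso t u -> t = u.
Proof.
elim/tree_seq_ind: t u => x ts IH [y us] /= /andP[st ct] /andP[su cu].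
move=> /tree_isoP[-> [us' pus tu]]; congr Node.
have {cu} cu' : all canonical us' by rewrite (perm_all _ pus).
(* Once the matched subtrees are equal, [ts] and [us] are sorted lists with the same members, hence
   equal. *)
suff tsu : ts = us'.
  apply: (irr_sorted_eq root_lt_trans _ st su) => [[? ?]|t]; first exact: ltnn.
  by rewrite tsu (perm_mem pus).
elim: ts us' IH ct {pus st} cu' tu => [|t ts IHts] [|u us'] //= IH.
move=> /andP[ct cts] /andP[cu cus] /andP[tu tus].
rewrite (IH t (mem_head _ _) u ct cu tu) (IHts us') // => v vts.
by apply: IH; rewrite inE vts orbT.
Qed.

Definition tree_shape (t : tree nat) : rtree := \pi_rtree (tmap (fun=> tt) t).

(** Increasing labels force 1 at the root, and the subtrees there form a forest on [2, ..., n]. *)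
Definition labelled_trees (n : nat) : seq (tree nat) :=
  if n is m.+1 then map (Node 1%N) (forests m (iota 2 m)) else [::].

Lemma size_labels (L : Type) (t : tree L) : size (labels t) = Defs.tsize t.
Proof.
elim/tree_nested_ind: t => x ts IH /=; congr _.+1.
by elim: ts IH => //= t ts IHts [e /IHts]; rewrite size_cat e => ->.
Qed.

Lemma rsize_tree_shape t : rsize (tree_shape t) = Defs.tsize t.
Proof. by rewrite rsizeE tsize_map. Qed.

Lemma labelled_treesP n t : t \in labelled_trees n ->
  [/\ canonical t, increasing t & perm_eq (labels t) (iota 1 n)].
Proof.
case: n => // n /mapP[f fs ->]; have ss := iota_ltn_sorted 2 n.
rewrite /= (forests_canonical ss fs) (forests_increasing ss fs).
have pf := forests_labels fs; rewrite perm_cons pf andbT; split=> //.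
apply/allP => y; rewrite [y \in _](perm_mem pf) mem_iota.
by case/andP.
Qed.

Lemma labelled_trees_uniq n : uniq (labelled_trees n).
Proof.
case: n => // n; rewrite map_inj_uniq; last by move=> ? ? [].
exact/forests_uniq/iota_ltn_sorted.
Qed.

Lemma labelled_trees_surj n t : increasing t -> perm_eq (labels t) (iota 1 n) ->
  exists2 u, u \in labelled_trees n & tree_iso t u.
Proof.
case: n t => [|n] [x ts]; first by move=> _ /perm_size.
move=> it pt.
have x1 : x = 1%N.
  have : 1%N \in labels (Node x ts) by rewrite (perm_mem pt) mem_head.
  have : x \in iota 1 n.+1 by rewrite -(perm_mem pt) mem_head.
  rewrite mem_iota => /andP[x0 _]; rewrite inE => /predU1P[//|].
  move: it => /= /andP[/allP h _] /h; rewrite ltnNge x0 //.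
subst x.
move: it => /= /andP[_ its].
have {}pt : perm_eq (flabels ts) (iota 2 n) by move: pt; rewrite /= perm_cons.
have [|f fs fi] := @forests_surj n (iota 2 n) ts _ (iota_ltn_sorted _ _) its pt.
- by rewrite size_iota.
- by exists (Node 1%N f); [exact: map_f|exact: (fi 1%N)].
Qed.

Lemma tree_iso_map (L M : eqType) (f : L -> M) t u :
  tree_iso t u -> tree_iso (tmap f t) (tmap f u).
Proof.
elim/tree_seq_ind: t u => x ts IH [y us] /tree_isoP[-> [us' pus tu]] /=.
apply/tree_isoP; split=> //; exists (map (tmap f) us'); first exact: perm_map.
elim: ts us' IH {pus} tu => [|t ts IHts] [|u us'] //= IH /andP[tu tus].
rewrite IH ?mem_head //= IHts // => v vts.
by apply: IH; rewrite inE vts orbT.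
Qed.

Lemma tree_shape_iso t u : tree_iso t u -> tree_shape t = tree_shape u.
Proof.
move=> tu; apply/(@eqquotP _ (tree_iso_equiv unit) rtree).
exact: tree_iso_map.
Qed.

(** Each isomorphism class is met at least once by [labelled_trees_surj], and at most once because
    isomorphic canonical trees are equal. *)
Lemma alphaE (t : rtree) :
  alpha t = count (fun u => tree_shape u == t) (labelled_trees (rsize t)).
Proof.
set s := labelled_trees _; set P := fun u => _.
pose r := [seq \pi_lrtree u | u <- s & P u].
have eqlr u v : \pi_lrtree u = \pi_lrtree v <-> tree_iso u v.
  by split=> [/(@eqquotP _ (tree_iso_equiv nat) lrtree)|uv] //;
    apply/(@eqquotP _ (tree_iso_equiv nat) lrtree).
have ur : uniq r.
  rewrite map_inj_in_uniq; first exact/filter_uniq/labelled_trees_uniq.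
  move=> u v; rewrite !mem_filter => /andP[_ /labelled_treesP[cu _ _]].
  move=> /andP[_ /labelled_treesP[cv _ _]] /eqlr; exact: canonical_iso_eq.
rewrite /alpha (_ : labellings t = [set` [fset x in r]%fset]).
  by rewrite set_fsetK card_fseq undup_id // size_map size_filter.
apply/seteqP; split=> x /=; rewrite !inE.
- move=> [T [Tt lT iT] <-].
  have [u us Tu] := labelled_trees_surj iT lT.
  rewrite (_ : \pi_lrtree T = \pi_lrtree u); last exact/eqlr.
  by apply: map_f; rewrite mem_filter us andbT /P -(tree_shape_iso Tu) -Tt.
- move=> /mapP[u]; rewrite mem_filter => /andP[/eqP ut /labelled_treesP[cu iu pu]] ->.
  by exists u.
Qed.

Lemma sum_rtrees_alpha (R : realType) n (F : rtree -> R) :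
  \sum_(t \in rtrees n) (alpha t)%:R * F t =
  \sum_(u <- labelled_trees n) F (tree_shape u).
Proof.
rewrite fsbig_finite; last exact: finite_rtrees.
under eq_big_seq => t.
  rewrite in_fset_set; last exact: finite_rtrees.
  rewrite inE /= => tn; rewrite alphaE tn -sum1_count natr_sum mulr_suml.
  over.
rewrite (exchange_big_dep xpredT) //= [LHS]big_seq [RHS]big_seq.
apply: eq_bigr => u /labelled_treesP[_ _ /perm_size].
rewrite size_labels size_iota => su.
(* For fixed [u] only [t = tree_shape u] contributes, and it lies in [rtrees n] because [u] has [n]
   nodes. *)
under eq_bigl do rewrite eq_sym.
rewrite -big_filter filter_pred1_uniq ?fset_uniq ?big_seq1 ?mul1r //.
rewrite in_fset_set; last exact: finite_rtrees.
by rewrite inE /rtrees /= rsize_tree_shape.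
Qed.

(** * The weight [t! B(t) delta_t] on labelled trees *)

Lemma tfold_tmap (L M A : Type) (F : nat -> seq A -> A) (f : L -> M) t :
  tfold F (tmap f t) = tfold F t.
Proof.
elim/tree_nested_ind: t => x ts IH.
rewrite /= -/(Defs.tsize _); congr (F _ _); last first.
  by elim: ts IH => //= t ts IHts [-> /IHts ->].
congr _.+1; elim: ts {IH} => //= t ts ->; congr (_ + _)%N; exact: tsize_map.
Qed.

Lemma rfold_tree_shape (A : eqType) (F : nat -> seq A -> A) t :
    (forall n s s', perm_eq s s' -> F n s = F n s') ->
  rfold F (tree_shape t) = tfold F t.
Proof.
by move=> FP; rewrite /rfold (tfold_iso FP (repr_iso _)) tfold_tmap.
Qed.

(** With [l n = n * b n], the root factors of the tree factorial and of the Green function merge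
    into [l]. A leaf gets the factor [psi 0], in place of the separate clause of [elem_diff]. *)
Definition weight (R : realType) (l psi : nat -> R) : tree nat -> R :=
  tfold (fun n vs => l n * (size vs)`!%:R * psi (size vs) * \prod_(v <- vs) v).

Lemma weight_Node (R : realType) (l psi : nat -> R) x f :
  weight l psi (Node x f) = l (size (flabels f)).+1 * (size f)`!%:R *
    psi (size f) * \prod_(t <- f) weight l psi t.
Proof.
rewrite /weight /= size_map big_map size_flatten /shape -map_comp.
congr (l (sumn _).+1 * _ * _ * _); apply: eq_map => t /=; exact/esym/size_labels.
Qed.

Lemma weight_tree_shape (R : realType) (b psi : nat -> R) t : psi 0%N = 1 ->
  (tree_factorial (tree_shape t))%:R * bare_green b (tree_shape t) *
    elem_diff psi (tree_shape t) = weight (fun n => n%:R * b n) psi t.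
Proof.
move=> psi0; rewrite /tree_factorial /bare_green /elem_diff.
rewrite !rfold_tree_shape; first last.
- by move=> n s s' p; rewrite (perm_big _ p).
- by move=> n s s' p; rewrite (perm_big _ p).
- move=> _ [|a s] [|a' s'] p //; try by have := perm_size p.
  by rewrite (perm_big _ p) (perm_size p).
have diffE (vs : seq R) : (if vs is [::] then 1
    else (size vs)`!%:R * psi (size vs) * \prod_(v <- vs) v) =
    (size vs)`!%:R * psi (size vs) * \prod_(v <- vs) v.
  by case: vs => //=; rewrite big_nil psi0 !mulr1.
rewrite /weight; elim/tree_nested_ind: t => x ts IH.
rewrite /= diffE !size_map !big_map natrM natr_prod.
set s := _.+1; set c := _ * psi _.
transitivity (s%:R * b s * c * (\prod_(t <- ts) (
    (tfold (fun n vs => n * \prod_(v <- vs) v)%N t)%:R *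
    tfold (fun n vs => b n * \prod_(v <- vs) v) t *
    tfold (fun=> fun vs => if vs is [::] then 1
      else (size vs)`!%:R * psi (size vs) * \prod_(v <- vs) v) t))).
  by rewrite !big_split /=; ring.
rewrite -!mulrA; do 4 congr (_ * _).
elim: ts IH {s c} => [|t ts IHts] /=; first by rewrite !big_nil.
by rewrite !big_cons => -[-> /IHts ->].
Qed.

(** * Binomial sums and derivatives of powers *)

Lemma sum_splits (R : realType) (h : nat -> nat -> R) s :
  \sum_(p <- splits s) h (size p.1) (size p.2) =
  \sum_(j < (size s).+1) 'C(size s, j)%:R * h j (size s - j)%N.
Proof.
elim: s h => [|x s IH] h /=; first by rewrite big_seq1 big_ord1 mul1r.
rewrite big_cat !big_map /= (IH (fun i j => h i.+1 j)) (IH (fun i j => h i j.+1)).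
set m := size s.
(* Pascal's rule yields two sums, one for each half that may receive [x]; a last term carrying
   ['C(m, m + 1) = 0] drops out. *)
rewrite [RHS]big_ord_recl bin0 /=.
under [in RHS]eq_bigr => j _ do
  rewrite /bump add1n subSS binS natrD mulrDl.
rewrite big_split /= addrA addrC; congr (_ + _).
rewrite big_ord_recl bin0 subn0 [in RHS]big_ord_recr /= bin_small // mul0r addr0.
congr (_ + _); first by rewrite subn0.
apply: eq_bigr => j _; rewrite /bump add1n.
by rewrite -subSn // subSS.
Qed.

(** Coefficients of a power below [N] see only those of [g] below [N]; truncation makes the
    derivative rule for polynomials available for series. *)
Lemma fps_exp_poly (R : realType) (g : nat -> R) N k n : (n < N)%N ->
  fps_exp g k n = ((\poly_(i < N) g i) ^+ k)`_n.
Proof.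
elim: k n => [|k IH] n nN; first by rewrite expr0 coef1.
rewrite /fps_exp iterS /fps_mul exprS coefM; apply: eq_bigr => j _.
rewrite coef_poly (leq_ltn_trans _ nN) ?leq_ord // -IH //.
by apply: leq_ltn_trans nN; exact: leq_subr.
Qed.

(* The coefficient of [z^n] in [(g^(k+1))' = (k+1) g' g^k]. *)
Lemma fps_exp_deriv (R : realType) (g : nat -> R) k n :
  n.+1%:R * fps_exp g k.+1 n.+1 =
  k.+1%:R * \sum_(j < n.+1) (j.+1%:R * g j.+1) * fps_exp g k (n - j)%N.
Proof.
set p := \poly_(i < n.+2) g i.
rewrite (@fps_exp_poly _ g n.+2) // -/p mulr_natl -coef_deriv deriv_exp.
rewrite coefMn /= coefM mulr_natl; congr (_ *+ _); apply: eq_bigr => j _.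
have jn : (j < n.+1)%N by [].
rewrite coef_deriv coef_poly ltnS jn mulr_natl (@fps_exp_poly _ g n.+2) //.
by rewrite ltnS (leq_trans (leq_subr _ _)) ?leqnSn.
Qed.

(** * Exponential generating functions of weighted forests *)

Section ForestSums.
Variables (R : realType) (l psi Y : nat -> R).
Hypothesis Y0 : Y 0%N = 0.
Hypothesis YS : forall n,
  Y n.+1 = (n.+1`!%:R)^-1 * \sum_(u <- labelled_trees n.+1) weight l psi u.

(** This is [F_k = Y^k / k!] read on coefficients. As a predicate of the fuel, it can be assumed by
    the lemmas on trees while it is being proved by induction. *)
Let forest_sums n := forall s k, (size s <= n)%N ->
  \sum_(f <- forests n s | size f == k) \prod_(t <- f) weight l psi t =
  (size s)`!%:R / k`!%:R * fps_exp Y k (size s).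

(** When forests are grouped by their number [k] of trees, the [k!] of the root weight cancels the
    [1 / k!] of [F_k]. *)
Lemma sum_trees n s x : forest_sums n -> (size s <= n)%N ->
  \sum_(f <- forests n s) weight l psi (Node x f) =
  l (size s).+1 * (size s)`!%:R * fps_comp psi Y (size s).
Proof.
move=> sumF sn; rewrite big_seq.
under eq_bigr => f fs do rewrite weight_Node (perm_size (forests_labels fs)).
rewrite -big_seq.
(* The inner sum has the single term [k = size f]; by [forests_size] it falls within the truncation
   used in [fps_comp]. *)
rewrite (eq_big_seq (fun f => \sum_(k < (size s).+1 | size f == k)
    l (size s).+1 * k`!%:R * psi k * \prod_(t <- f) weight l psi t)); last first.
  move=> f fs; rewrite (big_pred1 (Ordinal (forests_size fs : (_ < _.+1)%N))) //.
rewrite (exchange_big_dep xpredT) //= /fps_comp mulr_sumr.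
apply: eq_bigr => k _; rewrite -mulr_sumr sumF //.
by field; rewrite pnatr_eq0 -lt0n fact_gt0.
Qed.

Let deriv_of_sums n : forest_sums n -> n.+1%:R * Y n.+1 = l n.+1 * fps_comp psi Y n.
Proof.
move=> sumF; rewrite YS big_map (sum_trees _ sumF) size_iota //.
by rewrite factS natrM; field; rewrite nat1r !pnatr_eq0 -lt0n fact_gt0.
Qed.

Lemma sum_forests n : forest_sums n.
Proof.
(* Strong induction: [deriv_of_sums] is applied below at every [j <= size s], each time with
   [forest_sums j]. *)
elim/ltn_ind: n => n IH s k sn.
case: s sn => [|x s] sn.
  have -> : forests n [::] = [:: [::]] by case: (n).
  rewrite big_mkcond big_seq1 big_nil; case: k => [|k].
    by rewrite /fps_exp /= divr1 mul1r.
  by rewrite fps_exp_small // mulr0.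
case: n => // n in IH sn *; have {}sn : (size s <= n)%N by [].
case: k => [|k].
  rewrite /fps_exp /= mulr0 big1_seq // => f /andP[f0].
  by move=> /forests_consP[p [g [h [_ _ _ fE]]]]; rewrite fE in f0.
rewrite big_mkcond big_allpairs_dep.
(* Contribution of one split: a tree with root [x] and [i] labels below it, then [k] trees on the
   other [j] labels. *)
pose h i j := l i.+1 * i`!%:R * fps_comp psi Y i *
  (j`!%:R / k`!%:R * fps_exp Y k j).
transitivity (\sum_(p <- splits s) h (size p.1) (size p.2)).
  apply: eq_big_seq => p /mem_splits[/size_subseq s1 /size_subseq s2 _].
  rewrite big_allpairs /= /h -(sum_trees x (IH n (ltnSn n))); last first.
    exact: leq_trans s1 sn.
  rewrite -(IH n (ltnSn n)); last exact: leq_trans s2 sn.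
  rewrite mulr_suml; apply: eq_bigr => f _.
  rewrite mulr_sumr -big_mkcond /=; apply: eq_bigr => g _.
  by rewrite big_cons.
rewrite sum_splits; set m := size s.
(* The equation for trees turns the first factor into a coefficient of [Y'], and the binomial
   combines with [j!] and [(m - j)!] into [m!]. *)
transitivity (m`!%:R / k`!%:R *
    \sum_(j < m.+1) (j.+1%:R * Y j.+1) * fps_exp Y k (m - j)%N).
  rewrite mulr_sumr; apply: eq_bigr => j _.
  have jm : (j <= m)%N by rewrite -ltnS.
  rewrite deriv_of_sums; last by apply: IH; rewrite ltnS (leq_trans jm).
  by rewrite /h -(bin_fact jm) !natrM; ring.
(* Multiplied by [k + 1], the convolution of [Y'] with [Y^k] is the derivative of [Y^(k+1)]. *)
apply: (mulfI (_ : k.+1%:R != 0)); first by rewrite pnatr_eq0.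
rewrite mulrCA -fps_exp_deriv !factS !natrM.
by field; rewrite nat1r !pnatr_eq0 -lt0n fact_gt0.
Qed.

Lemma deriv_trees n : n.+1%:R * Y n.+1 = l n.+1 * fps_comp psi Y n.
Proof. exact/deriv_of_sums/sum_forests. Qed.

End ForestSums.

Theorem theorem1 (R : realType) (psi L b : nat -> R)
  (psi0 : psi 0%N = 1)
  (L_cvg : forall k : nat, (1 <= k)%N -> cvgn (pseries L k%:R))
  (b_L : forall k : nat, (1 <= k)%N -> b k = series_value L k%:R / k%:R) :
  pseries_diffs (tree_series b psi) =
  op_1theta L (fps_comp psi (tree_series b psi)).
Proof.
have YS n : tree_series b psi n.+1 = (n.+1`!%:R)^-1 *
    \sum_(u <- labelled_trees n.+1) weight (fun n => n%:R * b n) psi u.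
  under [in RHS]eq_bigr => u _ do rewrite -weight_tree_shape //.
  rewrite -(sum_rtrees_alpha n.+1 (fun t => (tree_factorial t)%:R *
    bare_green b t * elem_diff psi t)).
  rewrite /tree_series !fsbig_finite; try exact: finite_rtrees.
  rewrite mulr_sumr; apply: eq_big_seq => t.
  rewrite in_fset_set; last exact: finite_rtrees.
  by rewrite inE /rtrees /= => ->; rewrite !mulrA.
apply/funext => n; rewrite /pseries_diffs /op_1theta.
(* Here [l (n + 1) = (n + 1) * b (n + 1)] is the value [L(n + 1)], by which [L(1 + theta)]
   multiplies the coefficient of [z^n]. *)
rewrite (deriv_trees (tree_series0 b psi) YS) b_L //.
by rewrite mulrC [n.+1%:R * _]mulrC divfK ?pnatr_eq0.
Qed.
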